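(* Let $G$ be a cyclic group of order $n=2^m l$ with $l>1$ odd and $m\ge 0$, written as $G=L\oplus \mathbb{Z}/2^m\mathbb{Z}$ where $L$ has odd order $l$. Let $\{A,B,C\}$ be a rainbow-free $3$-coloring of $G$ with non-empty color classes. Then there is a proper subgroup $H'$ of $L$ such that one of the color classes, say $A$, is contained in one coset of $H=H'\oplus \mathbb{Z}/2^m\mathbb{Z}$, and each of $B\setminus H$ and $C\setminus H$ is $H$-periodic.
   Context: A $3$-coloring of $G$ is a partition of $G$ into three color classes $A,B,C$. A $3$-term arithmetic progression is an ordered triple $(x,y,z)\in G^3$ with $x+y=2z$; it is rainbow if its three members lie in pairwise distinct color classes. The coloring is rainbow-free if there is no rainbow $3$-term arithmetic progression. A subset $S\subseteq G$ is $H$-periodic if $S+H=S$.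
   Formalization: The sets shown H-periodic are B and C minus the coset of H containing A, not minus H itself; with H literally the claim fails, e.g. in Z/6 with A={1}, B={4}, C the rest. The two agree when A lies in H. *)

(* Defs.v *)
From mathcomp Require Import all_boot all_fingroup all_algebra.

Set Implicit Arguments.
Unset Strict Implicit.
Unset Printing Implicit Defensive.

Local Open Scope group_scope.

(* Groups are written multiplicatively, so x + y = 2z reads x * y = z ^+ 2. *)

Section RainbowColorings.

Variable gT : finGroupType.
Implicit Types (G H A B C S X : {set gT}) (x y z : gT).

(* Colour classes may be empty. *)
Definition three_coloring G A B C : Prop :=
  [/\ A :|: B :|: C = G, [disjoint A & B], [disjoint A & C] & [disjoint B & C]].

Definition same_class A B C x y : bool :=
  [|| (x \in A) && (y \in A), (x \in B) && (y \in B) | (x \in C) && (y \in C)].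

Definition AP3 G x y z : Prop :=
  [/\ x \in G, y \in G, z \in G & x * y = z ^+ 2].

Definition rainbow A B C x y z : Prop :=
  [/\ ~~ same_class A B C x y, ~~ same_class A B C x z
    & ~~ same_class A B C y z].

Definition rainbow_free G A B C : Prop :=
  forall x y z, AP3 G x y z -> ~ rainbow A B C x y z.

Definition periodic H S : Prop := S * H = S.

(* X is meant to be a coset of H.  The sets B \ X and C \ X replace the usual
   shorthand "B \ H and C \ H", which presupposes a translation taking X to H. *)
Definition coset_structure H X A B C : Prop :=
  [/\ A \subset X, periodic H (B :\: X) & periodic H (C :\: X)].

End RainbowColorings.

(* Main.v *)
(* Pull the colouring back to Z along i |-> g^i, where it is periodic and
   rainbow-free.  Take three positions of distinct colours with smallest span s:
   after a translation 0 is in A, s is in C and everything strictly between is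
   in B; then s is odd, and -s and 2s lie in A or C.
   - If -s is in A and 2s is in C, taking midpoints with -s, 0, s, 2s shows that
     all non-multiples of s are in B, so A lies in sZ.
   - If -s is in C (the case where 2s is in A is its mirror image), then 0 is the
     only element of A in [-s, s].  Enlarging the window (-N, N), one keeps a
     modulus m > 1 such that A lies in mZ and the colour of a non-multiple of m
     depends only on its residue; when N or -N joins A, m becomes gcd(m, N), and
     gcd 1 would force all non-multiples of m to have one colour, which
     reflecting N in a multiple of m of the other colour excludes.
   In both cases the differences of some class have a gcd D whose odd part q is
   greater than 1.  Off this class modulo q, reflections make the colouring
   2D-periodic and doubling preserves colours, so it is q-periodic. *)
Require Import Defs.
From mathcomp Require Import all_boot all_order all_fingroup all_algebra all_solvable.
From mathcomp Require Import zify ring.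

Set Implicit Arguments.
Unset Strict Implicit.
Unset Printing Implicit Defensive.

Import Order.TTheory GRing.Theory Num.Theory.

Ltac lin :=
  repeat match goal with
  | H : is_true (_ \in dvdz _) |- _ => clear H
  | H : is_true (_ \notin dvdz _) |- _ => clear H
  end; lia.

(** * Rainbow-free colourings of the integers and residue colourings of a window *)

Section IntegerColorings.

Local Open Scope ring_scope.

Variable T : eqType.
Implicit Types (c : int -> T) (x y z m n N : int).

Definition int_rainbow_free c :=
  forall x y z, x + y = z + z -> [\/ c x = c y, c x = c z | c y = c z].

(** The invariant kept while the window grows. The point [b] forces [m < N], so every residue has a
    representative in the window; it also serves as a mirror for new endpoints. *)
Definition residue_coloring c m N :=
  [/\ 1 < m,
      exists2 b, c b = c 0 & (b != 0) && (- N < b < N),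
      forall x, - N < x < N -> c x = c 0 -> (m %| x)%Z
    & forall x y, - N < x < N -> - N < y < N ->
        ~~ (m %| x)%Z -> (m %| x - y)%Z -> c x = c y].

Lemma int_rainbow_free_opp c :
  int_rainbow_free c -> int_rainbow_free (fun x => c (- x)).
Proof. by move=> rf x y z e; apply: rf; lia. Qed.

Lemma int_rainbow_free_shift c p :
  int_rainbow_free c -> int_rainbow_free (fun x => c (x + p)).
Proof. by move=> rf x y z e; apply: rf; lia. Qed.

Lemma reflect_color c x y z : int_rainbow_free c -> x + y = z + z ->
  c x <> c z -> c y <> c z -> c y = c x.
Proof. by move=> rf /rf[]. Qed.

Lemma residue_coloring_opp c m N :
  residue_coloring c m N -> residue_coloring (fun x => c (- x)) m N.
Proof.
move=> [m1 [b cb bN] dv per]; split=> //.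
- by exists (- b); rewrite ?opprK ?oppr0 //; lia.
- by move=> x xN; rewrite oppr0 => /dv; rewrite rpredN; apply; lia.
- move=> x y xN yN mx mxy; apply: per; [lia|lia|by rewrite rpredN|].
  by rewrite -opprD rpredN.
Qed.

Lemma residue_coloring_of_opp c m N :
  residue_coloring (fun x => c (- x)) m N -> residue_coloring c m N.
Proof.
move=> /residue_coloring_opp[m1 [b cb bN] dv per]; split=> //.
- by exists b => //; move: cb; rewrite opprK oppr0.
- by move=> x xN cx; apply: dv => //; rewrite opprK oppr0.
- by move=> x y xN yN mx d; have := per x y xN yN mx d; rewrite !opprK.
Qed.

Lemma dvdz_repr m x : 0 < m -> exists2 r, 0 <= r < m & (m %| x - r)%Z.
Proof.
move=> m0; exists (x %% m)%Z; first by rewrite modz_ge0 ?ltz_pmod; lia.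
by rewrite {1}(divz_eq x m) addrK dvdz_mull.
Qed.

Lemma dvdz_eqD m x y z : (m %| x)%Z -> (m %| y)%Z -> z = x + y -> (m %| z)%Z.
Proof. by move=> dx dy ->; apply: rpredD. Qed.

Lemma dvdz_eqB m x y z : (m %| x)%Z -> (m %| y)%Z -> z = x - y -> (m %| z)%Z.
Proof. by move=> dx dy ->; apply: rpredB. Qed.

Lemma dvdz_congr m x y : (m %| x - y)%Z -> (m %| x)%Z = (m %| y)%Z.
Proof.
move=> d; apply/idP/idP => h; first by rewrite -(subKr x y) rpredB.
by rewrite -(subrK y x) rpredD.
Qed.

Lemma ndvdz_small m x : 0 < x < m -> ~~ (m %| x)%Z.
Proof.
move=> xm; apply/negP => /dvdzP[q e]; rewrite {}e in xm.
by have [q0|q0|q0] := ltgtP q 0; nia.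
Qed.

(** * Enlarging the window by one position on each side *)

Lemma residue_coloring_lt c m N : residue_coloring c m N -> m < N.
Proof.
move=> [m1 [b cb /andP[b0 bN]] dv per].
have /dvdzP[q e] := dv b bN cb; rewrite {dv per cb}e in b0 bN.
by have [q0|q0|q0] := ltgtP q 0; nia.
Qed.

Lemma residue_coloring_even c m N x : int_rainbow_free c ->
  residue_coloring c m N -> - N < x < N -> ~~ (m %| x)%Z -> c (- x) = c x.
Proof.
move=> rf [m1 _ dv _] xN mx.
have n1 : c x <> c 0 by move=> /(dv _ xN); exact/negP.
have n2 : c (- x) <> c 0.
  by move=> /dv h; move: mx; rewrite -rpredN h //; lin.
by case: (rf x (- x) 0 ltac:(lin)).
Qed.

(** Put [y = N - x]. If [x] and [y] differ modulo [m], reflecting [N] in [x] and in [y] gives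
    [x - y] and [y - x]. These have the colours of [x] and [y], and agree by reflection in 0. *)
Lemma residue_coloring_complement c m N x : int_rainbow_free c ->
  residue_coloring c m N -> c N = c 0 -> 0 < x < N ->
  ~~ (m %| x)%Z -> ~~ (m %| N - x)%Z -> c (N - x) = c x.
Proof.
move=> rf [m1 _ dv per] cN xN mx my.
have [y yE] : exists y, y = N - x by exists (N - x).
rewrite -yE in my *.
have [d|nd] := boolP (m %| x - y)%Z.
  by symmetry; apply: per => //; lin.
have nA z : - N < z < N -> ~~ (m %| z)%Z -> c z <> c 0.
  by move=> zN mz /(dv _ zN); exact/negP.
have nd' : ~~ (m %| y - x)%Z by rewrite -opprB rpredN.
have h1 := nA x ltac:(lin) mx; have h2 := nA y ltac:(lin) my.
have h3 := nA (x - y) ltac:(lin) nd; have h4 := nA (y - x) ltac:(lin) nd'.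
have := rf N (x - y) x ltac:(lin); have := rf N (y - x) y ltac:(lin).
have := rf (x - y) (y - x) 0 ltac:(lin).
by case=> ?; case=> ?; case=> ?; congruence.
Qed.

(** Translation by [N] is [x -> - x] followed by [x -> N - x], read modulo [m]. *)
Lemma residue_coloring_translate c m N x y : int_rainbow_free c ->
  residue_coloring c m N -> c N = c 0 -> - N < x < N -> - N < y < N ->
  ~~ (m %| x)%Z -> ~~ (m %| y)%Z -> (m %| y - (x + N))%Z -> c x = c y.
Proof.
move=> rf rc cN xN yN mx my d.
have mN := residue_coloring_lt rc; have [m1 _ _ per] := rc.
rewrite -(residue_coloring_even rf rc xN mx).
(* The second reflection is available only on [(0, N)], so [- x] is first moved to its residue in
   [[0, m)]. *)
have [x0 x0m dx] := @dvdz_repr m (- x) ltac:(lin).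
have mx0 : ~~ (m %| x0)%Z by rewrite -(dvdz_congr dx) rpredN.
have x0N : 0 < x0.
  rewrite lt_def (andP x0m).1 andbT.
  by apply: contra mx0 => /eqP->; exact: dvdz0.
have dy : (m %| N - x0 - y)%Z.
  by apply: (dvdz_eqB dx d); lin.
have -> : c (- x) = c x0 by apply: per => //; rewrite ?rpredN //; lin.
have my0 : ~~ (m %| N - x0)%Z by rewrite (dvdz_congr dy).
rewrite -(residue_coloring_complement rf rc cN _ mx0 my0); last lin.
by apply: per => //; lin.
Qed.

(** The points [x + N * j] may leave the window, so each is replaced by its residue; multiples of
    [m] must be avoided, since the invariant does not fix their colours. *)
Lemma residue_coloring_translate_iter c m N (k : nat) x y :
  int_rainbow_free c -> residue_coloring c m N -> c N = c 0 ->
  - N < x < N -> - N < y < N ->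
  (forall j : nat, (j <= k)%N -> ~~ (m %| x + N * j%:Z)%Z) ->
  (m %| y - (x + N * k%:Z))%Z -> c x = c y.
Proof.
move=> rf rc cN xN; have mN := residue_coloring_lt rc.
have [m1 _ _ per] := rc; elim: k y => [|k IH] y yN nd d.
  have := nd 0%N isT; rewrite mulr0 addr0 in d * => mx.
  by apply: per => //; rewrite -opprB rpredN.
have [y' y'm dk] := @dvdz_repr m (x + N * k%:Z) ltac:(lin).
have -> : c x = c y'.
  apply: IH; [lin|by move=> j jk; apply: nd; lin|].
  by rewrite -opprB rpredN.
apply: (residue_coloring_translate rf rc cN) => //; first lin.
- by rewrite -(dvdz_congr dk) nd.
- by rewrite (dvdz_congr d) nd.
by apply: (dvdz_eqD d dk); rewrite -addn1 PoszD mulrDr mulr1; lin.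
Qed.

(** In the coprime case the multiples of [N] reach all nonzero residues, so the non-multiples of [m]
    share one colour. One of [z], [w] has neither this colour nor that of 0, hence is a multiple of
    [m]; reflecting [N] in it gives a rainbow progression. *)
Lemma residue_coloring_not_coprime c m N z w :
  int_rainbow_free c -> residue_coloring c m N -> c N = c 0 ->
  0 < z < N -> 0 < w < N -> c z <> c 0 -> c w <> c 0 -> c z <> c w ->
  ~~ coprimez m N.
Proof.
move=> rf rc cN zN wN cz cw czw; apply/negP => cop.
have mN := residue_coloring_lt rc; have [m1 _ dv _] := rc.
have nN (j : nat) : (0 < j)%N -> j%:Z < m -> ~~ (m %| N * j%:Z)%Z.
  by move=> j0 jm; rewrite Gauss_dvdzr // ndvdz_small //; lin.
have [y0 y0m dN] := @dvdz_repr m N ltac:(lin).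
have const x : - N < x < N -> ~~ (m %| x)%Z -> c x = c y0.
  move=> xN mx; have [u [v]] := Bezoutz m N.
  rewrite (eqP cop) => bez.
  have [k km dk] := @dvdz_repr m (v * x) ltac:(lin).
  have dxk : (m %| x - N * k)%Z.
    apply: (dvdz_eqD (dvdz_mulr (u * x) (dvdzz m)) (dvdz_mull N dk)).
    by rewrite -[x in LHS]mulr1 -bez; ring.
  have k0 : 0 < k.
    rewrite lt_def (andP km).1 andbT; apply: contra mx => /eqP k0.
    by rewrite k0 mulr0 subr0 in dxk.
  (* The walk starts at [y0], which already stands for one copy of [N]; hence [k - 1] steps. *)
  symmetry; apply: (@residue_coloring_translate_iter c m N `|k - 1|%N) => //.
  - lin.
  - move=> j jk; rewrite -(@dvdz_congr m (N * (j.+1)%:Z)); first by apply: nN; lin.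
    by rewrite -addn1 PoszD (_ : _ - _ = N - y0) //; ring.
  have -> : (absz (k - 1))%:Z = k - 1 by lin.
  by apply: (dvdz_eqD dxk dN); ring.
have [t [tN ct0 ct]] : exists t, [/\ 0 < t < N, c t <> c 0 & c t <> c y0].
  have [e|/eqP e] := eqVneq (c z) (c y0); [exists w|exists z]; split=> //.
  by congruence.
have mt : (m %| t)%Z.
  by apply/negPn/negP => /const h; apply: ct; apply: h; lin.
have mN' : ~~ (m %| N)%Z by have := nN 1%N isT m1; rewrite mulr1.
have mr : ~~ (m %| t + t - N)%Z.
  apply: contra mN' => h.
  by apply: (dvdz_eqB (rpredD mt mt) h); lin.
have h1 := const (t + t - N) ltac:(lin) mr.
have h2 : c (t + t - N) <> c 0.
  by move=> /dv h; move: mr; rewrite h //; lin.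
by case: (rf N (t + t - N) t ltac:(lin)); congruence.
Qed.

(** By Bezout, points congruent modulo the gcd are joined, modulo [m], by translations by [N]; from
    a non-multiple of the gcd these never meet a multiple of [m]. The new endpoints are multiples of
    the gcd. *)
Lemma residue_coloring_refine c m N z w :
  int_rainbow_free c -> residue_coloring c m N -> c N = c 0 ->
  0 < z < N -> 0 < w < N -> c z <> c 0 -> c w <> c 0 -> c z <> c w ->
  residue_coloring c (gcdz m N) (N + 1).
Proof.
move=> rf rc cN zN wN cz cw czw.
have ncop := residue_coloring_not_coprime rf rc cN zN wN cz cw czw.
have mN := residue_coloring_lt rc; have [m1 _ dv _] := rc.
have gm := dvdz_gcdl m N; have gN := dvdz_gcdr m N.
have gE : gcdz m N = (gcdn `|m| `|N|)%:Z by [].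
have g1 : 1 < gcdz m N.
  rewrite gE lt_def; apply/andP; split; first by move: ncop.
  have : (0 < gcdn `|m| `|N|)%N by rewrite gcdn_gt0; apply/orP; left; lin.
  by lin.
have [g ge] : exists g, g = gcdz m N by exists (gcdz m N).
have [u [v]] := Bezoutz m N; rewrite -ge in gm gN g1 * => bez.
have nN x : - (N + 1) < x < N + 1 -> ~~ (g %| x)%Z -> - N < x < N.
  move=> xN gx; have [e|/eqP ne] := eqVneq x N; first by rewrite e gN in gx.
  have [e|/eqP ne'] := eqVneq x (- N); first by rewrite e rpredN gN in gx.
  by lin.
split=> //.
- by exists N => //; lin.
- move=> x xN cx; apply/negPn/negP => gx; have xN' := nN _ xN gx.
  by move: gx; rewrite (dvdz_trans gm) // dv.
move=> x y xN yN gx gxy; have xN' := nN _ xN gx.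
have yN' : - N < y < N by apply: nN => //; rewrite -(dvdz_congr gxy).
have /dvdzP[q e] := gxy.
have [k km dk] := @dvdz_repr m (- q * v) ltac:(lin).
apply: (@residue_coloring_translate_iter c m N `|k|%N) => //.
- move=> j _; apply: contra gx => h.
  by apply: (dvdz_eqB (dvdz_trans gm h) (dvdz_mulr j%:Z gN)); ring.
have -> : (absz k)%:Z = k by lin.
apply: (dvdz_eqD (dvdz_mulr (- q * u) (dvdzz m)) (dvdz_mull N dk)).
have -> : y = x - q * g by rewrite -e; ring.
by rewrite -bez; ring.
Qed.

(** Only the endpoints are new, and they share a colour by reflection in 0. A reflection in [b], a
    multiple of [m], links them to a point of the old window with the right residue. *)
Lemma residue_coloring_extend c m N : int_rainbow_free c ->
  residue_coloring c m N -> c N <> c 0 -> c (- N) <> c 0 ->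
  residue_coloring c m (N + 1).
Proof.
move=> rf rc cN cN'; have [m1 [b cb /andP[b0 bN]] dv per] := rc.
split=> //.
- by exists b => //; lin.
- move=> x xN cx; apply: dv => //.
  have ne : x <> N by move=> e; rewrite e in cx.
  have ne' : x <> - N by move=> e; rewrite e in cx.
  by lin.
have eN : c (- N) = c N.
  by apply: (reflect_color rf (z := 0)) => //; lin.
have redN : ~~ (m %| N)%Z ->
    exists x', [/\ - N < x' < N, (m %| N - x')%Z & c N = c x'].
  move=> mN; have mb := dv _ bN cb; have mbb := rpredD mb mb.
  have nd s t : (m %| s - t)%Z -> ~~ (m %| s)%Z -> - N < t < N -> c t <> c 0.
    by move=> d ms tN ct; move: ms; rewrite (dvdz_congr d) dv.
  (* For [b > 0], [b + b - N] mirrors [N] and its opposite is congruent to [N]; for [b < 0],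
     [N + (b + b)] mirrors [- N]. *)
  have [bp|bn] := ltP 0 b.
    have d : (m %| N - (N - (b + b)))%Z.
      by rewrite (_ : N - _ = b + b) //; ring.
    have x'N : - N < N - (b + b) < N by lin.
    have n1 := nd _ _ d mN x'N.
    have mN' : ~~ (m %| N - (b + b))%Z by rewrite -(dvdz_congr d).
    exists (N - (b + b)); split=> //.
    rewrite -(residue_coloring_even rf rc x'N mN') opprB.
    have n2 : c (b + b - N) <> c 0.
      by rewrite -opprB (residue_coloring_even rf rc x'N mN').
    by symmetry; apply: (reflect_color rf (z := b)); rewrite ?cb //; lin.
  have d : (m %| N - (N + (b + b)))%Z.
    by rewrite (_ : N - _ = - (b + b)) ?rpredN //; ring.
  have x'N : - N < N + (b + b) < N by lin.
  have n1 := nd _ _ d mN x'N.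
  exists (N + (b + b)); split=> //; rewrite -eN.
  by symmetry; apply: (reflect_color rf (z := b)); rewrite ?cb //; lin.
have red x : - (N + 1) < x < N + 1 -> ~~ (m %| x)%Z ->
    exists x', [/\ - N < x' < N, (m %| x - x')%Z & c x = c x'].
  move=> xN mx; have [e|/eqP ne] := eqVneq x N.
    by rewrite e in mx *; exact: redN.
  have [e|/eqP ne'] := eqVneq x (- N); last first.
    by exists x; split=> //; [lin|rewrite subrr dvdz0].
  rewrite e rpredN in mx *; have [x' [x'N d cx']] := redN mx.
  have mx' : ~~ (m %| x')%Z by rewrite -(dvdz_congr d).
  exists (- x'); split; first lin.
    by rewrite -opprB rpredN opprK addrC.
  by rewrite eN (residue_coloring_even rf rc).
move=> x y xN yN mx d; have my : ~~ (m %| y)%Z by rewrite -(dvdz_congr d).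
have [x' [x'N dx ->]] := red _ xN mx; have [y' [y'N dy ->]] := red _ yN my.
apply: per => //; first by rewrite -(dvdz_congr dx).
by apply: (dvdz_eqB (rpredD d dy) dx); ring.
Qed.

(** The conditions at [- z] and [- w] let the two witnesses serve for the mirrored colouring too,
    when it is [- N] that joins the class of 0. *)
Lemma residue_coloring_step c m N z w :
  int_rainbow_free c -> residue_coloring c m N ->
  0 < z < N -> 0 < w < N -> c z <> c 0 -> c w <> c 0 ->
  c (- z) <> c 0 -> c (- w) <> c 0 -> c z <> c w ->
  exists m', residue_coloring c m' (N + 1).
Proof.
move=> rf rc zN wN cz cw cz' cw' czw.
have [e|/eqP cN] := eqVneq (c N) (c 0).
  by exists (gcdz m N); apply: (residue_coloring_refine rf rc e zN wN).
have [e|/eqP cN'] := eqVneq (c (- N)) (c 0); last first.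
  by exists m; exact: residue_coloring_extend.
have ez : c (- z) = c z by apply: (reflect_color rf (z := 0)) => //; lin.
have ew : c (- w) = c w by apply: (reflect_color rf (z := 0)) => //; lin.
exists (gcdz m N); apply: residue_coloring_of_opp.
apply: (residue_coloring_refine (int_rainbow_free_opp rf)
  (residue_coloring_opp rc) _ zN wN); rewrite ?oppr0 //.
by rewrite ez ew.
Qed.

(** The first window, with modulus [a]. As 0 is alone in its class on [(- a, a)], the reflections
    [x -> - x] and [x -> a - x] preserve colours there, and together they give the shift by [a]. *)
Lemma residue_coloring_base c (a : int) z w :
  int_rainbow_free c -> c a = c 0 -> 0 < z < a -> 0 < w < a -> c z <> c w ->
  (forall x, - a < x < a -> c x = c 0 -> x = 0) ->
  residue_coloring c a (a + 1).
Proof.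
move=> rf ca za wa czw iso.
have zw : z <> w by move=> e; rewrite e in czw.
have ev x : - a < x < a -> c (- x) = c x.
  move=> xa; have [->|/eqP x0] := eqVneq x 0; first by rewrite oppr0.
  have n1 : c x <> c 0 by move=> /(iso _ xa).
  have n2 : c (- x) <> c 0 by move/iso; lin.
  by apply: (reflect_color rf (z := 0)) => //; lin.
have co x : 0 < x < a -> c (a - x) = c x.
  move=> xa; have [y yE] : exists y, y = a - x by exists (a - x).
  rewrite -yE; have [e|/eqP ne] := eqVneq x y; first by rewrite e.
  have n1 : c x <> c 0 by move/iso; lin.
  have n2 : c y <> c 0 by move/iso; lin.
  have n3 : c (x - y) <> c 0 by move/iso; lin.
  have e4 : c (y - x) = c (x - y) by rewrite -opprB ev //; lin.
  have := rf a (x - y) x ltac:(lin); have := rf a (y - x) y ltac:(lin).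
  by case=> ?; case=> ?; congruence.
have na x : - (a + 1) < x < a + 1 -> ~~ (a %| x)%Z -> - a < x < a /\ x <> 0.
  move=> xa ax; have [e|/eqP ne] := eqVneq x a; first by rewrite e dvdzz in ax.
  have [e|/eqP ne'] := eqVneq x (- a); first by rewrite e rpredN dvdzz in ax.
  have [e|/eqP ne0] := eqVneq x 0; first by rewrite e dvdz0 in ax.
  by lin.
split; first lin.
- by exists a => //; lin.
- move=> x xa cx; apply/negPn/negP => ax; have [xa' x0] := na _ xa ax.
  by apply: x0; exact: iso.
move=> x y xa ya ax d; have [xa' x0] := na _ xa ax.
have [ya' y0] : - a < y < a /\ y <> 0 by apply: na; rewrite -?(dvdz_congr d).
have /dvdzP[q e] := d.
have [h|[h|h]] : x = y \/ (x = y + a \/ y = x + a).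
  have q1 : - 2 < q < 2 by nia.
  have [h|[h|h]] : q = 0 \/ (q = 1 \/ q = -1) by lin.
  - by left; rewrite h in e; lin.
  - by right; left; rewrite h in e; lin.
  - by right; right; rewrite h in e; lin.
- by rewrite h.
- by rewrite -(ev y) // -(co (- y)) ?opprK; [congr c; lin|lin].
- by rewrite -(ev x) // -(co (- x)) ?opprK; [congr c; lin|lin].
Qed.

(** * A class with an isolated point lies in a proper subgroup *)

Lemma periodic_int c n k x : (forall y, c (y + n) = c y) -> c (x + k * n) = c x.
Proof.
move=> per; have pn (j : nat) y : c (y + j%:Z * n) = c y.
  elim: j y => [|j IH] y; first by rewrite mul0r addr0.
  by rewrite -addn1 PoszD mulrDl mul1r addrA per.
have [k0|k0] := leP 0 k; first by rewrite -(pn `|k|%N x); congr c; nia.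
by rewrite -(pn `|k|%N (x + k * n)); congr c; nia.
Qed.

(** Start at the least [a > 0] with [a] or [- a] in the class of 0 and grow the window until it
    contains [[0, n]]. Then [m] divides [n], which is in the class, and periodicity covers all
    integers. *)
Lemma isolated_class_dvdz c n d z w : int_rainbow_free c ->
  0 < n -> (forall x, c (x + n) = c x) ->
  (forall x, - d < x < d -> c x = c 0 -> x = 0) ->
  0 < z < d -> 0 < w < d -> c z <> c w ->
  exists2 m, 1 < m & forall x, c x = c 0 -> (m %| x)%Z.
Proof.
move=> rf n0 per iso zd wd czw.
have cn : c n = c 0 by rewrite -{1}(add0r n) per.
pose P (a : nat) := (0 < a)%N && ((c a%:Z == c 0) || (c (- a%:Z) == c 0)).
have exP : exists a, P a.
  exists `|n|%N; rewrite /P (_ : (absz n)%:Z = n) ?cn ?eqxx ?andbT; lin.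
have [a /andP[a0 ca] amin] := ex_minnP exP.
have isoa x : - a%:Z < x < a%:Z -> c x = c 0 -> x = 0.
  move=> xa cx; apply/eqP/negPn/negP => x0.
  have : P `|x|%N.
    apply/andP; split; first lin.
    have [xp|xn] := leP 0 x; apply/orP.
      by left; rewrite (_ : (absz x)%:Z = x) ?cx //; lin.
    by right; rewrite (_ : - (absz x)%:Z = x) ?cx //; lin.
  by move/amin; lin.
have da : d <= a%:Z.
  rewrite leNgt; apply/negP => ad.
  by case/orP: ca => /eqP /iso; lin.
have ns x : 0 < x < d -> c x <> c 0 /\ c (- x) <> c 0.
  by move=> xd; split; move/iso; lin.
have [cz cz'] := ns z zd; have [cw cw'] := ns w wd.
have base : residue_coloring c a%:Z (a%:Z + 1).
  case/orP: ca => /eqP ca.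
    by apply: (residue_coloring_base rf ca (z := z) (w := w)) => //; lin.
  have ez : c (- z) = c z by apply: (reflect_color rf (z := 0)) => //; lin.
  have ew : c (- w) = c w by apply: (reflect_color rf (z := 0)) => //; lin.
  apply: residue_coloring_of_opp.
  apply: (residue_coloring_base (int_rainbow_free_opp rf) (z := z) (w := w)).
  - by rewrite oppr0.
  - lin.
  - lin.
  - by rewrite ez ew.
  - by move=> x xa; rewrite oppr0 => /isoa; lin.
have [m [m1 _ dv _]] : exists m, residue_coloring c m (a%:Z + n + 1).
  have -> : n = (absz n)%:Z by lin.
  elim: `|n|%N => [|k [m IH]]; first by exists a%:Z; rewrite addr0.
  have [m' rc] := residue_coloring_step rf IH (z := z) (w := w)
    ltac:(lin) ltac:(lin) cz cw cz' cw' czw.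
  by exists m'; move: rc; rewrite (_ : a%:Z + k.+1 + 1 = a%:Z + k + 1 + 1) //; lin.
exists m => // x cx; have [r rn /dvdzP[q e]] := @dvdz_repr n x n0.
have dn : (m %| n)%Z by apply: dv => //; lin.
have dr : (m %| r)%Z.
  apply: dv; first lin.
  by rewrite -cx -(subrK r x) e addrC periodic_int.
by rewrite -(subrK r x) e rpredD // dvdz_mull.
Qed.

(** * Three-coloured triples of minimal span *)

Lemma ndvdz_half s x h e : ~~ (s %| x)%Z -> (s %| e)%Z -> h + h = x + e ->
  ~~ (s %| h)%Z.
Proof.
move=> sx se hE; apply: contra sx => sh.
by apply: (dvdz_eqB (rpredD sh sh) se); lin.
Qed.

Lemma half_parity x s : (exists h, s = h + h + 1) ->
  exists h, h + h = x \/ h + h = x + s.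
Proof.
move=> [t ->]; have [e|e] : x = (x %/ 2)%Z + (x %/ 2)%Z \/
  x = (x %/ 2)%Z + (x %/ 2)%Z + 1 by lia.
  by exists (x %/ 2)%Z; left; lia.
by exists ((x %/ 2)%Z + t + 1); right; lia.
Qed.

Section MinimalSpan.

Variables (c : int -> T) (s u : int).
Hypotheses (rf : int_rainbow_free c) (us : 0 < u < s).
Hypotheses (c0u : c 0 <> c u) (c0s : c 0 <> c s) (cus : c u <> c s).
Hypothesis min_span : forall i j k, i < j < k ->
  c i <> c j -> c i <> c k -> c j <> c k -> s <= k - i.

(** Another colour at [x] would give, with two of [0], [u], [s], a three-coloured triple of smaller
    span. *)
Lemma min_span_inner x : 0 < x < s -> c x = c u.
Proof.
move=> xs; apply/eqP/negPn/negP => /eqP xu.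
have [lt|gt|e] := ltgtP x u; last by rewrite e in xu.
- have [e|/eqP ne] := eqVneq (c x) (c s).
    by have := @min_span 0 x u ltac:(lin) ltac:(congruence) ltac:(congruence)
      ltac:(congruence); lin.
  by have := @min_span x u s ltac:(lin) ltac:(congruence) ltac:(congruence)
    ltac:(congruence); lin.
have [e|/eqP ne] := eqVneq (c x) (c 0).
  by have := @min_span u x s ltac:(lin) ltac:(congruence) ltac:(congruence)
    ltac:(congruence); lin.
by have := @min_span 0 u x ltac:(lin) ltac:(congruence) ltac:(congruence)
  ltac:(congruence); lin.
Qed.

Lemma min_span_odd : exists h, s = h + h + 1.
Proof.
exists (s %/ 2)%Z.
have [e|//] : s = (s %/ 2)%Z + (s %/ 2)%Z \/ s = (s %/ 2)%Z + (s %/ 2)%Z + 1.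
  by lia.
have hs : 0 < (s %/ 2)%Z < s by lia.
have ch := min_span_inner hs.
by case: (rf (x := 0) (y := s) (z := (s %/ 2)%Z) ltac:(lia)); congruence.
Qed.

(** An odd point of [(- s, 0)] has its midpoint with [s] inside [(0, s)], so it is not in the class
    of 0; hence [- 1] has colour [c u]. An even point of that class would form with [- s] and [- 1]
    a triple of span [s - 1]. *)
Lemma min_span_isolated : c (- s) = c s ->
  forall x, - (s + 1) < x < s + 1 -> c x = c 0 -> x = 0.
Proof.
move=> cNs; have [t sE] := min_span_odd.
have neg_odd h : 0 < h + h + 1 < s -> c (- (h + h + 1)) <> c 0.
  move=> hs e; have := @min_span_inner (t - h) ltac:(lia).
  by case: (rf (x := - (h + h + 1)) (y := s) (z := t - h) ltac:(lia)); congruence.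
have cN1 : c (- 1) = c u.
  have n1 : c (- 1) <> c 0 by apply: (@neg_odd 0); lia.
  have e1 := @min_span_inner 1 ltac:(lia).
  by case: (rf (x := 1) (y := - 1) (z := 0) ltac:(lia)); congruence.
move=> x xs cx; apply/eqP/negPn/negP => /eqP x0.
have [xp|xn] := ltP 0 x.
  have [e|/eqP ne] := eqVneq x s; first by rewrite e in cx; congruence.
  by have := @min_span_inner x ltac:(lia); congruence.
have [e|/eqP ne] := eqVneq x (- s); first by rewrite e in cx; congruence.
have [e|e] : - x = (- x %/ 2)%Z + (- x %/ 2)%Z + 1 \/
             - x = (- x %/ 2)%Z + (- x %/ 2)%Z by lia.
  apply: (@neg_odd (- x %/ 2)%Z); first lia.
  by rewrite -e opprK.
suff : s <= - 1 - - s by lia.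
apply: (@min_span _ x); rewrite ?cNs ?cN1 ?cx //; try exact: nesym.
by lia.
Qed.

(** Induction on the distance to the centre [s / 2]. Since [s] is odd, each of the anchor pairs
    [- s, 0] and [s, 2s] has a member of the parity of [x]. If [x] lacked colour [c u], so would its
    midpoint with an anchor of another colour, a non-multiple of [s] nearer the centre. *)
Lemma min_span_const : c (- s) = c 0 -> c (s + s) = c s ->
  forall x, ~~ (s %| x)%Z -> c x = c u.
Proof.
move=> cNs cSs; have odds := min_span_odd.
have mid x y h : h + h = x + y -> c x <> c y -> c x <> c u -> c y <> c u ->
    c h <> c u.
  by move=> e n1 n2 n3; case: (rf (x := x) (y := y) (z := h) ltac:(lin)); congruence.
suff H (k : nat) x : `|x + x - s| < k%:Z -> ~~ (s %| x)%Z -> c x = c u.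
  by move=> x; apply: (H (absz (x + x - s)%R).+1); lin.
elim: k x => [|k IH] x xk sx; first by lin.
have [/min_span_inner //|xo] := boolP (0 < x < s).
have xNs : x <> s by move=> e; rewrite e dvdzz in sx.
have x2s : x <> s + s by move=> e; rewrite e rpredD ?dvdzz in sx.
have x0 : x <> 0 by move=> e; rewrite e dvdz0 in sx.
have xms : x <> - s by move=> e; rewrite e rpredN dvdzz in sx.
have ds := dvdzz s; have dNs : (s %| - s)%Z by rewrite rpredN.
have d2s := rpredD ds ds.
have via y h : h + h = x + y -> (s %| y)%Z -> c x <> c y -> c y <> c u ->
    `|h + h - s| < k%:Z -> c x = c u.
  move=> hE sy n1 n2 hk; apply/eqP/negPn/negP => /eqP n3.
  apply: (mid x y h) => //; apply: IH => //.
  by apply: (ndvdz_half sx sy); lin.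
have via0 : c x <> c 0 -> (s < x) || (x < - s) -> c x = c u.
  move=> n1 xr; have [h [e|e]] := half_parity (x - s) odds.
    by apply: (via (- s) h) => //; [congruence|congruence|lin].
  by apply: (via 0 h) => //; lin.
have viaS : c x <> c s -> (s + s < x) || (x < 0) -> c x = c u.
  move=> n1 xr; have [h [e|e]] := half_parity (x + s) odds.
    by apply: (via s h) => //; [congruence|lin].
  by apply: (via (s + s) h) => //; [lin|congruence|congruence|lin].
(* On [(s, 2s)] and [(- s, 0)] one anchor pair may not bring the midpoint nearer; reflecting in [s]
   or 0 excludes the colour that would need that pair. *)
have [x1|x1] := boolP (s < x < s + s).
  apply: via0; last lin.
  have := @min_span_inner (s + s - x) ltac:(lin).
  by case: (rf (x := x) (y := s + s - x) (z := s) ltac:(lin)); congruence.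
have [x2|x2] := boolP (- s < x < 0).
  apply: viaS; last lin.
  have := @min_span_inner (- x) ltac:(lin).
  by case: (rf (x := x) (y := - x) (z := 0) ltac:(lin)); congruence.
have [e|/eqP ne] := eqVneq (c x) (c 0); first by apply: viaS; [congruence|lin].
by apply: via0 => //; lin.
Qed.

End MinimalSpan.

(** Periodicity moves the left end into [[0, n)], so whether a span occurs is a finite, decidable
    question. *)
Lemma min_span_exists c n x y z : 0 < n -> (forall x, c (x + n) = c x) ->
  c x <> c y -> c x <> c z -> c y <> c z ->
  exists p s u, [/\ 0 < u < s, c p <> c (p + u), c p <> c (p + s),
    c (p + u) <> c (p + s)
    & forall i j k, i < j < k ->
        c i <> c j -> c i <> c k -> c j <> c k -> s <= k - i].
Proof.
move=> n0 per xy xz yz.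
pose rb i j k := [&& c i != c j, c i != c k & c j != c k].
have rbP i j k : c i <> c j -> c i <> c k -> c j <> c k -> rb i j k.
  by move=> /eqP h1 /eqP h2 /eqP h3; apply/and3P.
pose P (s : nat) := [exists i : 'I_`|n|, [exists u : 'I_s,
  (0 < u)%N && rb i%:Z (i%:Z + u%:Z) (i%:Z + s%:Z)]].
have memP i j k : i < j < k -> rb i j k -> P `|k - i|%N.
  move=> ijk h; have [r rn /dvdzP[q e]] := @dvdz_repr n i n0.
  have rlt : (`|r| < `|n|)%N by lin.
  have ult : (`|(j - i)%R| < `|(k - i)%R|)%N by lin.
  apply/existsP; exists (Ordinal rlt); apply/existsP; exists (Ordinal ult) => /=.
  apply/andP; split; first lin.
  have E v w : v - i = w -> c v = c (r + w).
    move=> <-; rewrite -(@periodic_int c n q (r + (v - i)) per); congr c.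
    by rewrite -e; ring.
  have -> : (absz r)%:Z = r by lin.
  have -> : (absz (j - i)%R)%:Z = j - i by lin.
  have -> : (absz (k - i)%R)%:Z = k - i by lin.
  move: h; rewrite /rb (E i 0) ?subrr // addr0.
  by rewrite (E j (j - i)) // (E k (k - i)).
have srt i j k : i < j < k -> c i <> c j -> c i <> c k -> c j <> c k ->
    exists s, P s.
  by move=> lt h1 h2 h3; exists `|k - i|%N; apply: (memP i j k) => //; apply: rbP.
have exP : exists s, P s.
  have nxy : x <> y by move=> e; rewrite e in xy.
  have nxz : x <> z by move=> e; rewrite e in xz.
  have nyz : y <> z by move=> e; rewrite e in yz.
  have [h|[h|[h|[h|[h|h]]]]] : x < y < z \/ (x < z < y \/ (y < x < z \/
    (y < z < x \/ (z < x < y \/ z < y < x)))) by lin.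
  1-6: by apply: (srt _ _ _ h); congruence.
have [s /existsP[p /existsP[u /andP[u0 /and3P[/eqP h1 /eqP h2 /eqP h3]]]] smin] :=
  ex_minnP exP.
exists p%:Z, s%:Z, u%:Z; split=> //; first by have := ltn_ord u; lin.
by move=> i j k ijk n1 n2 n3; have := smin _ (memP i j k ijk (rbP _ _ _ n1 n2 n3)); lin.
Qed.

(** The final disjunction will exclude that the gcd of the class is a power of two. *)
Lemma class_in_coset c n x y z : int_rainbow_free c ->
  0 < n -> (forall x, c (x + n) = c x) ->
  c x <> c y -> c x <> c z -> c y <> c z ->
  exists p m, [/\ 1 < m, forall x, c x = c p -> (m %| x - p)%Z
    & (exists h, m = h + h + 1) \/
      exists h k, [/\ c (p + (h + h + 1)) <> c p, c (p + (k + k + 1)) <> c p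
        & c (p + (h + h + 1)) <> c (p + (k + k + 1))]].
Proof.
move=> rf n0 per xy xz yz.
have [p [s [u [us c0u c0s cus smin]]]] := min_span_exists n0 per xy xz yz.
have iso d : int_rainbow_free d -> (forall x, d (x + n) = d x) ->
    d 0 <> d u -> d 0 <> d s -> d u <> d s ->
    (forall i j k, i < j < k -> d i <> d j -> d i <> d k -> d j <> d k ->
       s <= k - i) -> d (- s) = d s ->
    exists m h, [/\ 1 < m, forall x, d x = d 0 -> (m %| x)%Z,
      d 1 <> d 0, d (h + h + 1) <> d 0 & d 1 <> d (h + h + 1)].
  move=> rfd perd d0u d0s dus dmin dNs.
  have d1 : d 1 = d u by apply: (min_span_inner us d0u d0s dus dmin); lin.
  have [h sE] := min_span_odd rfd us d0u d0s dus dmin.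
  have h1 := min_span_isolated rfd us d0u d0s dus dmin dNs.
  have [|||m m1 dm] := isolated_class_dvdz rfd n0 perd h1 (z := 1) (w := s).
  - by lin.
  - by lin.
  - by congruence.
  by exists m, h; rewrite -sE; split=> //; congruence.
pose d x := c (x + p).
have rfd : int_rainbow_free d by exact: int_rainbow_free_shift.
have perd x' : d (x' + n) = d x' by rewrite /d addrAC per.
have dE v : d v = c (p + v) by rewrite /d addrC.
have d0 : d 0 = c p by rewrite dE addr0.
rewrite -d0 -!dE in c0u c0s cus.
have dmin i j k : i < j < k -> d i <> d j -> d i <> d k -> d j <> d k ->
    s <= k - i.
  move=> ijk n1 n2 n3.
  have := smin (i + p) (j + p) (k + p) ltac:(lin) n1 n2 n3; lin.
have [e1|n1] := eqVneq (d (- s)) (d s).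
  have [m [h [m1 dm h1 h2 h3]]] := iso d rfd perd c0u c0s cus dmin e1.
  exists p, m; split=> //.
    by move=> x' cx'; apply: dm; rewrite dE addrC subrK d0.
  by right; exists 0, h; rewrite -!dE -d0 !add0r.
have [e2|n2] := eqVneq (d (s + s)) (d 0).
  (* This mirror swaps 0 and [s] and turns the condition at [2s] into the one at [- s]. *)
  pose d' x := d (s - x).
  have rfd' : int_rainbow_free d'.
    by move=> i j k e; apply: rfd; lin.
  have perd' i : d' (i + n) = d' i.
    by rewrite /d' -(perd (s - (i + n))); congr d; ring.
  have us' : 0 < s - u < s by lin.
  have dSu : d (s - u) = d u by apply: (min_span_inner us c0u c0s cus dmin).
  have d'0 : d' 0 = d s by rewrite /d' subr0.
  have d's : d' s = d 0 by rewrite /d' subrr.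
  have d'u : d' u = d u by [].
  have d'Ns : d' (- s) = d 0 by rewrite /d' opprK.
  have [|||||m [h [m1 dm h1 h2 h3]]] := iso d' rfd' perd'.
  - by congruence.
  - by congruence.
  - by congruence.
  - move=> i j k ijk m1 m2 m3.
    by have := dmin (s - k) (s - j) (s - i) ltac:(lin) (nesym m3) (nesym m2)
      (nesym m1); lin.
  - by rewrite d'Ns d's.
  exists (p + s), m; split=> //.
    move=> x' cx'; rewrite -opprB rpredN; apply: dm.
    by rewrite d'0 dE -cx' /d' /d; congr c; ring.
  (* The odd offsets are [- 1] and [- (h + h + 1)], mirrored from [1] and [h + h + 1]. *)
  right; exists (- 1), (- h - 1).
  have E1 : c (p + s + (- 1 - 1 + 1)) = d' 1 by rewrite /d' /d; congr c; ring.
  have E2 : c (p + s + (- h - 1 + (- h - 1) + 1)) = d' (h + h + 1).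
    by rewrite /d' /d; congr c; ring.
  by rewrite E1 E2 -dE -d'0.
have d1 : d (- s) = d 0.
  case: (rfd (- s) s 0 ltac:(lin)) => [e|//|e]; last by congruence.
  by rewrite e eqxx in n1.
have d2 : d (s + s) = d s.
  case: (rfd (s + s) 0 s ltac:(lin)) => [e|//|e]; last by congruence.
  by rewrite e eqxx in n2.
have const := min_span_const rfd us c0u c0s cus dmin d1 d2.
exists p, s; split.
- by lin.
- move=> x' cx'; apply/negPn/negP => /const.
  by rewrite dE addrC subrK cx' -d0; congruence.
- by left; exact: (min_span_odd rfd us c0u c0s cus dmin).
Qed.

(** * From the gcd of a class to periodicity outside it *)

Definition double_period c q t :=
  (q %| t)%Z /\ forall x, ~~ (q %| x)%Z -> c (x + (t + t)) = c x.

Lemma double_period0 c q : double_period c q 0.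
Proof. by split=> [|x _]; rewrite ?dvdz0 // !addr0. Qed.

(** The condition [q %| t] keeps shifted points off the multiples of [q], so shifts compose. *)
Lemma double_periodD c q t t' :
  double_period c q t -> double_period c q t' -> double_period c q (t + t').
Proof.
move=> [qt pt] [qt' pt']; split=> [|x qx]; first exact: rpredD.
rewrite -(pt x qx) -(pt' (x + (t + t))); first by congr c; ring.
by rewrite (@dvdz_congr q _ x) // (_ : _ - x = t + t) ?rpredD //; ring.
Qed.

Lemma double_periodN c q t : double_period c q t -> double_period c q (- t).
Proof.
move=> [qt pt]; split=> [|x qx]; first by rewrite rpredN.
rewrite -(pt (x + (- t + - t))); first by congr c; ring.
by rewrite (@dvdz_congr q _ x) // (_ : _ - x = - (t + t)) ?rpredN ?rpredD //; ring.
Qed.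

Lemma double_periodM c q k t : double_period c q t -> double_period c q (k * t).
Proof.
move=> pt; have pn (j : nat) : double_period c q (j%:Z * t).
  elim: j => [|j IH]; first by rewrite mul0r; exact: double_period0.
  by rewrite -addn1 PoszD mulrDl mul1r; exact: double_periodD.
have [k0|k0] := leP 0 k; first by have -> : k = (absz k)%:Z by lin.
have -> : k * t = - ((absz k)%:Z * t) by rewrite -mulNr; congr (_ * _); lin.
exact: double_periodN.
Qed.

Lemma double_period_gcd c q (t t' : nat) : double_period c q t%:Z ->
  double_period c q t'%:Z -> double_period c q (gcdn t t')%:Z.
Proof.
move=> pt pt'; have [u [v]] := Bezoutz t%:Z t'%:Z.
by rewrite /gcdz /= => <-; apply: double_periodD; exact: double_periodM.
Qed.

Lemma even_color c q x : int_rainbow_free c ->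
  (forall x, c x = c 0 -> (q %| x)%Z) -> ~~ (q %| x)%Z -> c (- x) = c x.
Proof.
move=> rf cq qx; apply: (reflect_color rf (z := 0)); first by lin.
  by move/cq; exact/negP.
by move/cq; rewrite rpredN; exact/negP.
Qed.

Lemma double_color c q x : int_rainbow_free c ->
  (forall x, c x = c 0 -> (q %| x)%Z) -> ~~ (q %| x + x)%Z -> c (x + x) = c x.
Proof.
move=> rf cq qxx.
have n1 : c (x + x) <> c 0 by move/cq; exact/negP.
have n2 : c x <> c 0 by move/cq => qx; case/negP: qxx; exact: rpredD.
by case: (rf 0 (x + x) x ltac:(lin)); congruence.
Qed.

Lemma double_color_iter c q x (k : nat) : int_rainbow_free c ->
  (forall x, c x = c 0 -> (q %| x)%Z) -> ~~ (q %| (2 ^ k)%N%:Z * x)%Z ->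
  c ((2 ^ k)%N%:Z * x) = c x.
Proof.
move=> rf cq; elim: k => [|k IH]; first by rewrite expn0 mul1r.
have -> : (2 ^ k.+1)%N%:Z * x = (2 ^ k)%N%:Z * x + (2 ^ k)%N%:Z * x.
  by rewrite expnS mul2n -addnn PoszD mulrDl.
move=> qk; rewrite (double_color rf cq) // IH //.
by apply: contra qk => h; exact: rpredD.
Qed.

(** Reflection in 0 followed by reflection in [a] is the shift by [2a]; off the multiples of [q]
    both preserve colours. *)
Lemma double_period_class c q a : int_rainbow_free c ->
  (forall x, c x = c 0 -> (q %| x)%Z) -> c a = c 0 -> double_period c q a.
Proof.
move=> rf cq ca; split=> [|x qx]; first exact: cq.
have qa := cq _ ca; rewrite -(even_color rf cq qx).
apply: (reflect_color rf (z := a)); first by lin.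
  by rewrite ca => /cq; rewrite rpredN; exact/negP.
rewrite ca => /cq h; case/negP: qx.
by apply: (dvdz_eqB h (rpredD qa qa)); ring.
Qed.

(** The index [n] is included so that, for an [n]-periodic [c], the gcd divides [n] and thus the
    whole class of 0. *)
Definition class_gcd c (n : nat) : nat :=
  \big[gcdn/0%N]_(i < n.+1 | c i%:Z == c 0) i.

Lemma double_period_class_gcd c q (n : nat) : int_rainbow_free c ->
  (forall x, c x = c 0 -> (q %| x)%Z) -> double_period c q (class_gcd c n)%:Z.
Proof.
move=> rf cq; apply: (big_ind (fun t : nat => double_period c q t%:Z)).
- exact: double_period0.
- by move=> t t'; exact: double_period_gcd.
- by move=> i /eqP ci; exact: double_period_class.
Qed.

Lemma dvd_class_gcd c q (n : nat) : (forall x, c x = c 0 -> (q %| x)%Z) ->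
  (q %| (class_gcd c n)%:Z)%Z.
Proof.
move=> cq; apply: (big_ind (fun t : nat => (q %| t%:Z)%Z)).
- exact: dvdz0.
- by move=> t t' qt qt'; rewrite -[Posz _]/(gcdz t%:Z t'%:Z) dvdz_gcd qt.
- by move=> i /eqP; exact: cq.
Qed.

Lemma class_gcd_dvd c (n : nat) x : (0 < n)%N -> (forall x, c (x + n%:Z) = c x) ->
  c x = c 0 -> ((class_gcd c n)%:Z %| x)%Z.
Proof.
move=> n0 per cx; have [r rn /dvdzP[q e]] := @dvdz_repr n%:Z x ltac:(lin).
have xE : x = r + q * n%:Z by rewrite -e; ring.
have small (i : nat) : (i <= n)%N -> c i%:Z = c 0 -> ((class_gcd c n)%:Z %| i%:Z)%Z.
  rewrite -ltnS => ilt ci; rewrite /class_gcd (bigD1 (Ordinal ilt)) /=; last exact/eqP.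
  by rewrite dvdzE /= dvdn_gcdl.
have cn : c n%:Z = c 0 by rewrite -[in LHS](add0r n%:Z) per.
have rE : (absz r)%:Z = r by lin.
rewrite xE rpredD //.
  by rewrite -rE; apply: small; [lin|rewrite rE -cx xE periodic_int].
by rewrite dvdz_mull // small.
Qed.

Lemma odd_ndvdz_mul2 (q : nat) x (k : nat) : odd q -> ~~ (q%:Z %| x)%Z ->
  ~~ (q%:Z %| (2 ^ k)%N%:Z * x)%Z.
Proof.
move=> oq; apply: contra; rewrite Gauss_dvdzr //.
by rewrite coprimezE /= coprime_sym coprimeXl // coprime2n.
Qed.

(* 2^k x is congruent to 2^k or -2^k modulo 2^(k+2) when x is odd. *)
Lemma odd_positions_color c (k : nat) h : int_rainbow_free c ->
  (forall x, c x = c 0 -> ((2 ^ k.+1)%N%:Z %| x)%Z) ->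
  double_period c (2 ^ k.+1)%N%:Z (2 ^ k.+1)%N%:Z ->
  c (h + h + 1) = c (2 ^ k)%N%:Z.
Proof.
move=> rf cq pq; set K := (2 ^ k)%N%:Z; set q := (2 ^ k.+1)%N%:Z in cq pq.
have K0 : 0 < K by rewrite /K ltz_nat expn_gt0.
have qE : q = K + K by rewrite /q expnS mul2n -addnn PoszD.
have nd y : ~~ (q %| K * (y + y + 1))%Z.
  apply/negP => /dvdzP[r e].
  have : K * (y + y + 1) = K * (r + r) by rewrite e qE; ring.
  by move=> /(mulfI (lt0r_neq0 K0)); lin.
rewrite -(double_color_iter rf cq (nd h)) -/K.
have ndK : ~~ (q %| K)%Z by have := nd 0; rewrite !add0r mulr1.
have [t [e|e]] : exists t, h = t + t \/ h = t + t + 1.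
  by exists (h %/ 2)%Z; lia.
  have [_ pt] := double_periodM t pq.
  by rewrite -[RHS](pt K) //; congr c; rewrite e qE; ring.
have [_ pt] := double_periodM (t + 1) pq.
rewrite -(even_color rf cq ndK) -[RHS](pt (- K)) ?rpredN //; congr c.
by rewrite e qE; ring.
Qed.

Theorem periodic_coloring_structure c (n : nat) x y z :
  int_rainbow_free c -> (0 < n)%N -> (forall x, c (x + n%:Z) = c x) ->
  c x <> c y -> c x <> c z -> c y <> c z ->
  exists p (q : nat), [/\ odd q, (1 < q)%N,
    forall x, c x = c p -> (q%:Z %| x - p)%Z
    & forall x, ~~ (q%:Z %| x - p)%Z -> c (x + q%:Z) = c x].
Proof.
move=> rf n0 per xy xz yz.
have n0' : 0 < n%:Z by lin.
have [p [m [m1 cm oddm]]] := class_in_coset rf n0' per xy xz yz.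
pose d x := c (x + p).
have rfd : int_rainbow_free d by exact: int_rainbow_free_shift.
have perd x' : d (x' + n%:Z) = d x' by rewrite /d addrAC per.
have d0 : d 0 = c p by rewrite /d add0r.
have dE v : d v = c (p + v) by rewrite /d addrC.
have dm x' : d x' = d 0 -> (m %| x')%Z.
  by rewrite d0 => /cm; rewrite addrK.
set D := class_gcd d n.
have dD x' : d x' = d 0 -> (D%:Z %| x')%Z by exact: class_gcd_dvd.
have mD : (m %| D%:Z)%Z by exact: dvd_class_gcd.
have D0 : (0 < D)%N.
  rewrite lt0n; apply/negP => /eqP D0.
  have := dD n%:Z; rewrite -[in d _](add0r n%:Z) perd D0 => /(_ erefl).
  by rewrite dvd0z; lin.
have [q cop DE] := pfactor_coprime (isT : prime 2) D0.
set k := logn 2 D in DE.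
have oq : odd q by rewrite -coprime2n.
have qD : (q%:Z %| D%:Z)%Z by rewrite DE PoszM dvdz_mulr.
have dq x' : d x' = d 0 -> (q%:Z %| x')%Z.
  by move=> /dD; exact: dvdz_trans.
have q1 : (1 < q)%N.
  (* If [q = 1], then [D] is a power of two, which an odd [m > 1] cannot divide. Otherwise [m > 1]
     excludes [D = 1], and [odd_positions_color] gives both odd offsets one colour. *)
  rewrite ltnNge; apply/negP => q1.
  have {q1} q1 : q = 1%N by move: oq q1; case: q {cop DE qD dq} => [|[|]].
  rewrite q1 mul1n in DE.
  case: oddm => [[h mE]|[h [j [h1 h2 h3]]]].
    have : ~~ (m %| (2 ^ k)%N%:Z * 1)%Z.
      have -> : m = (absz m)%:Z by lin.
      apply: odd_ndvdz_mul2; first by lia.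
      by apply: ndvdz_small; lin.
    by rewrite mulr1 -DE mD.
  case Ek : k DE => [|k'] DE.
    by move: (ndvdz_small (m := m) (x := 1) ltac:(lin)); rewrite DE expn0 in mD *; rewrite mD.
  have pD := double_period_class_gcd n rfd dD.
  rewrite -/D DE in pD; rewrite DE in dD.
  by apply: h3; rewrite -!dE !(odd_positions_color _ rfd dD pD).
exists p, q; split=> //.
  by move=> x' cx'; apply: dq; rewrite d0 /d subrK.
move=> x' qx'; have [_ pD] := double_period_class_gcd n rfd dq.
have dp v : ~~ (q%:Z %| v)%Z -> d (v + q%:Z) = d v.
  move=> qv.
  have qv' : ~~ (q%:Z %| v + q%:Z)%Z.
    by rewrite (@dvdz_congr _ _ v) // addrAC subrr add0r.
  (* Multiplying by [2 ^ k.+1] preserves these colours and turns the shift by [q] into the shift by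
     [2D]. *)
  rewrite -(double_color_iter rfd dq (odd_ndvdz_mul2 k.+1 oq qv)).
  rewrite -(double_color_iter rfd dq (odd_ndvdz_mul2 k.+1 oq qv')).
  rewrite -[RHS]pD; last exact: odd_ndvdz_mul2.
  congr d; rewrite -/D DE PoszM expnS mul2n -addnn PoszD; ring.
by have := dp _ qx'; rewrite /d addrAC subrK.
Qed.

End IntegerColorings.

(** * Passing between a cyclic group and the integers *)

Section CyclicColorings.

Local Open Scope group_scope.

Variables (gT : finGroupType) (g : gT).

Definition zpow (i : int) : gT := g ^+ `|(i %% #[g])%Z|%N.

Lemma zpow_nat (k : nat) : zpow k = g ^+ k.
Proof. by rewrite /zpow modz_nat absz_nat expg_mod_order. Qed.

Lemma zpow_cycle i : zpow i \in <[g]>.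
Proof. exact: mem_cycle. Qed.

Lemma zpowD i j : zpow (i + j)%R = zpow i * zpow j.
Proof.
rewrite /zpow -expgD; apply/eqP; rewrite eq_expg_mod_order.
have n0 : (#[g]%:Z != 0)%R by rewrite -lt0n order_gt0.
by rewrite -eqz_nat -!modz_nat PoszD !gez0_abs ?modz_ge0 // modz_mod modzDm.
Qed.

Lemma zpow_periodic i : zpow (i + #[g]%:Z)%R = zpow i.
Proof. by rewrite zpowD zpow_nat expg_order mulg1. Qed.

Lemma zpow_dvdz (q : nat) i : (q %| #[g])%N -> (q%:Z %| i)%Z ->
  zpow i \in <[g ^+ q]>.
Proof.
move=> qn qi; have : (q%:Z %| (i %% #[g])%Z)%Z.
  have qn' : (q%:Z %| #[g]%:Z)%Z by [].
  by rewrite -[(_ %% _)%Z]/(i - _)%R rpredB // dvdz_mull.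
rewrite dvdzE /= => /dvdnP[k e].
by rewrite /zpow e mulnC expgM mem_cycle.
Qed.

Variables (A B C : {set gT}).
Hypothesis col3 : three_coloring <[g]> A B C.

(** The default value [2] stands for [C] only on [<[g]>]. *)
Definition color (x : gT) : nat :=
  if x \in A then 0%N else if x \in B then 1%N else 2%N.

Lemma mem_color x : x \in <[g]> ->
  [/\ (x \in A) = (color x == 0%N), (x \in B) = (color x == 1%N)
    & (x \in C) = (color x == 2%N)].
Proof.
move=> Gx; have [U dAB dAC dBC] := col3.
move: Gx; rewrite -U !inE /color.
have := disjointFr dAB (x := x); have := disjointFr dAC (x := x).
have := disjointFr dBC (x := x).
case: (x \in A) => [_ -> // -> //|]; case: (x \in B) => [-> //|] _ _ _.
by case: (x \in C).
Qed.

Lemma same_class_color x y : x \in <[g]> -> y \in <[g]> ->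
  same_class A B C x y = (color x == color y).
Proof.
move=> Gx Gy; rewrite /same_class.
have [-> -> ->] := mem_color Gx; have [-> -> ->] := mem_color Gy.
rewrite /color; case: (x \in A); case: (x \in B);
  by case: (y \in A); case: (y \in B).
Qed.

Lemma zpow_color_rainbow_free : rainbow_free <[g]> A B C ->
  int_rainbow_free (fun i => color (zpow i)).
Proof.
move=> rf x y z e.
have ap : AP3 <[g]> (zpow x) (zpow y) (zpow z).
  by split; rewrite ?zpow_cycle // -zpowD e zpowD.
have [exy|/eqP nxy] := eqVneq (color (zpow x)) (color (zpow y)).
  by apply: Or31.
have [exz|/eqP nxz] := eqVneq (color (zpow x)) (color (zpow z)).
  by apply: Or32.
have [eyz|/eqP nyz] := eqVneq (color (zpow y)) (color (zpow z)).
  by apply: Or33.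
case: (rf _ _ _ ap); rewrite /rainbow !same_class_color ?zpow_cycle //.
by split; apply/eqP.
Qed.

Variables (p : int) (q : nat).
Hypothesis qn : (q %| #[g])%N.
Hypothesis class_p : forall i,
  color (zpow i) = color (zpow p) -> (q%:Z %| (i - p)%R)%Z.
Hypothesis periodic_q : forall i, ~~ (q%:Z %| (i - p)%R)%Z ->
  color (zpow (i + q%:Z)%R) = color (zpow i).

Let X := <[g ^+ q]> :* zpow p.

Lemma zpow_coset i : (q%:Z %| (i - p)%R)%Z -> zpow i \in X.
Proof.
move=> d; rewrite mem_rcoset -(subrK p i) zpowD mulgK.
exact: zpow_dvdz.
Qed.

Lemma cycle_zpow x : x \in <[g]> -> exists i, x = zpow i.
Proof. by case/cycleP=> k ->; exists (Posz k); rewrite zpow_nat. Qed.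

Lemma monochromatic_sub (S : {set gT}) k : zpow p \in S ->
  S \subset <[g]> -> (forall x, x \in <[g]> -> (x \in S) = (color x == k)) ->
  S \subset X.
Proof.
move=> Sp sSG SE; apply/subsetP => x Sx; have Gx := subsetP sSG x Sx.
have [i xE] := cycle_zpow Gx; rewrite xE in Sx Gx *.
apply/zpow_coset/class_p; move: Sx Sp; rewrite !SE ?zpow_cycle //.
by move=> /eqP-> /eqP->.
Qed.

(** Multiplying by [g ^+ q] shifts exponents by [q], which preserves colours outside [X] and never
    enters [X]. *)
Lemma monochromatic_periodic (S : {set gT}) k : S \subset <[g]> ->
  (forall x, x \in <[g]> -> (x \in S) = (color x == k)) ->
  periodic <[g ^+ q]> (S :\: X).
Proof.
move=> sSG SE; apply/eqP; rewrite eqEsubset; apply/andP; split; last first.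
  by apply/subsetP=> x Sx; rewrite -(mulg1 x) mem_mulg // group1.
apply/subsetP => _ /mulsgP[x h /setDP[Sx nX] Hh ->].
have Gx := subsetP sSG x Sx; have [i xE] := cycle_zpow Gx.
have Gh : h \in <[g]>.
  by apply: (subsetP _ _ Hh); rewrite cycle_subG mem_cycle.
have nd : ~~ (q%:Z %| (i - p)%R)%Z.
  by apply: contra nX => /zpow_coset; rewrite xE.
apply/setDP; split; last first.
  apply: contra nX; rewrite !mem_rcoset.
  have -> : x * h = h * x.
    by have /centsP := cycle_abelian g; apply.
  by rewrite -mulgA groupMl.
case/cycleP: Hh => j hE.
suff /eqP e : color (x * h) == color x by rewrite SE ?groupM // e -SE.
rewrite hE xE; elim: j {hE} => [|j /eqP IH]; first by rewrite expg0 mulg1.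
have E (t : nat) : zpow i * (g ^+ q) ^+ t = zpow (i + (q * t)%N%:Z)%R.
  by rewrite zpowD zpow_nat expgM.
rewrite -IH !E mulnS addnC PoszD addrA periodic_q //.
have -> : (q%:Z %| (i + (q * j)%N%:Z - p)%R)%Z = (q%:Z %| (i - p)%R)%Z.
  apply: dvdz_congr; rewrite (_ : _ - _ = (q * j)%N%:Z)%R; last by ring.
  by rewrite PoszM dvdz_mulr.
exact: nd.
Qed.

End CyclicColorings.

(** * The subgroups and the coset in the cyclic group *)

Local Open Scope group_scope.

Theorem theorem7 (gT : finGroupType) (G L K : {group gT}) (m l : nat)
    (A B C : {set gT}) :
  cyclic G ->
  #|G| = (2 ^ m * l)%N ->
  (1 < l)%N ->
  odd l ->
  L \x K = G ->
  #|L| = l ->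
  K \isog Zp (2 ^ m) ->
  three_coloring G A B C ->
  rainbow_free G A B C ->
  A != set0 -> B != set0 -> C != set0 ->
  exists (H' H : {group gT}) (X : {set gT}),
    [/\ H' \proper L,
        H' \x K = H,
        X \in rcosets H G
      & [\/ coset_structure H X A B C,
            coset_structure H X B A C
          | coset_structure H X C A B]].
Proof.
move=> cycG oG l1 ol defG oL _ col3 rf A0 B0 C0.
have [g GE] := cyclicP cycG.
have defK : #|K| = (2 ^ m)%N.
  have := dprod_card defG; rewrite oG oL mulnC => /eqP.
  by rewrite eqn_pmul2r ?(ltnW l1) // => /eqP.
have /dprodP[_ mulLK cLK tiLK] := defG.
rewrite GE in col3 rf; have n0 := order_gt0 g.
have [U _ _ _] := col3.
have sA : A \subset <[g]> by rewrite -U -setUA subsetUl.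
have sB : B \subset <[g]> by rewrite -U setUAC subsetUr.
have sC : C \subset <[g]> by rewrite -U subsetUr.
have AE x := fun Gx => let: And3 h _ _ := mem_color col3 (x := x) Gx in h.
have BE x := fun Gx => let: And3 _ h _ := mem_color col3 (x := x) Gx in h.
have CE x := fun Gx => let: And3 _ _ h := mem_color col3 (x := x) Gx in h.
pose c i := color A B (zpow g i).
have ex (S : {set gT}) k : S != set0 -> S \subset <[g]> ->
    (forall x, x \in <[g]> -> (x \in S) = (color A B x == k)) ->
    exists i, c i = k.
  case/set0Pn=> x Sx sSG SE; have Gx := subsetP sSG x Sx.
  have [i xE] := cycle_zpow Gx; exists i.
  by apply/eqP; rewrite /c -xE -SE.
have [a ca] := ex A 0%N A0 sA AE; have [b cb] := ex B 1%N B0 sB BE.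
have [d cd] := ex C 2%N C0 sC CE.
have per i : c (i + #[g]%:Z)%R = c i by rewrite /c zpow_periodic.
have nab : c a <> c b by rewrite ca cb.
have nad : c a <> c d by rewrite ca cd.
have nbd : c b <> c d by rewrite cb cd.
have [p [q [oq q1 cp pq]]] := periodic_coloring_structure
  (zpow_color_rainbow_free col3 rf) n0 per nab nad nbd.
(* Both [p] and [p + #[g]] have the colour of [p], so [q] divides their difference. *)
have qn : (q %| #[g])%N.
  by have := cp _ (per p); rewrite addrAC subrr add0r.
pose H := <[g ^+ q]>%G; pose H' := (H :&: L)%G.
have sHG : H \subset G by rewrite GE cycle_subG mem_cycle.
have oH : #|H| = (#[g] %/ q)%N by rewrite -orderE orderXdiv.
(* In a cyclic group inclusion of subgroups is divisibility of orders, and [2 ^ m] divides [#[g] %/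
   q] because [q] is odd. *)
have sKH : K \subset H.
  have sKG : K \subset G by rewrite -mulLK mulG_subr.
  rewrite -(cardSg_cyclic cycG) // defK oH dvdn_divRL //.
  have -> : #[g] = (2 ^ m * l)%N by rewrite -oG GE.
  rewrite dvdn_pmul2l ?expn_gt0 // -(@Gauss_dvdr q (2 ^ m)).
    by rewrite -oG GE.
  by rewrite coprime_sym coprimeXl // coprime2n.
exists H', H, (H :* zpow g p); split.
(* Otherwise [H] contains [L] and [K], hence [G], against its index [q > 1]. *)
- rewrite properE subsetIr subsetI subxx andbT; apply/negP => sLH.
  have : G \subset H by rewrite -mulLK mul_subG.
  move=> /subset_leq_card; rewrite oH leqNgt GE -orderE ltn_Pdiv //.
- rewrite dprodE.
  + by rewrite group_modr // mulLK; apply/setIidPl.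
  + by rewrite (subset_trans cLK) // centS // subsetIr.
  + by rewrite -setIA tiLK setIg1.
- by apply/rcosetsP; exists (zpow g p); rewrite ?GE ?zpow_cycle.
have perS := monochromatic_periodic qn pq.
have subS := monochromatic_sub qn cp.
have : zpow g p \in <[g]> by exact: zpow_cycle.
(* The class containing [zpow g p] is the one inside the coset. *)
rewrite -{1}U !inE -orbA => /or3P[Ap|Bp|Cp].
- by apply: Or31; split; [apply: subS AE|apply: perS BE|apply: perS CE].
- by apply: Or32; split; [apply: subS BE|apply: perS AE|apply: perS CE].
- by apply: Or33; split; [apply: subS CE|apply: perS AE|apply: perS BE].
Qed.
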